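(* Let $G$ be a finitely generated branch group. If $G$ contains an element $\alpha$ whose centraliser $C_G(\alpha)$ is not finitely generated, then $G$ is intersection-saturated.
   Context: Branch group: let $T$ be a spherically homogeneous rooted tree (every vertex at level $n$ has the same number $m_{n+1}\geq 2$ of children). A group $G$ is a branch group if it acts faithfully on $T$, transitively on each level of $T$, and for every $n$ the rigid level stabiliser $\mathrm{Rist}_G(n)=\prod_{v \text{ at level } n}\mathrm{Rist}_G(v)$ has finite index in $G$, where $\mathrm{Rist}_G(v)$ is the subgroup of elements of $G$ acting trivially outside the subtree rooted at $v$. For an integer $n\geq 1$ write $[n]=\{1,\dots,n\}$. An $n$-configuration is a map $c\colon \mathcal{P}([n])\setminus\{\emptyset\}\to\{0,1\}$. An $n$-configuration $c$ is realisable in a group $G$ if there exist subgroups $H_1,\dots,H_n\leq G$ such that for every non-empty subset $I\subseteq[n]$, the subgroup $\bigcap_{i\in I}H_i$ is finitely generated if and only if $c(I)=0$. A group $G$ is intersection-saturated if for every $n\geq 1$, every $n$-configuration is realisable in $G$. *)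

(* Defs.v *)
From mathcomp Require Import all_boot.
From Stdlib Require List.
Set Implicit Arguments. Unset Strict Implicit. Unset Printing Implicit Defensive.

Local Open Scope group_scope.

Section GroupNotions.
Variable G : groupType.

Definition is_subgroup (H : G -> Prop) : Prop :=
  H 1 /\ (forall x y, H x -> H y -> H (x * y)) /\
  (forall x, H x -> H x^-1).

Inductive gen (S : G -> Prop) : G -> Prop :=
| gen_base : forall x, S x -> gen S x
| gen_one : gen S 1
| gen_mul : forall x y, gen S x -> gen S y -> gen S (x * y)
| gen_inv : forall x, gen S x -> gen S x^-1.

Definition fin_gen (H : G -> Prop) : Prop :=
  exists s : list G, forall x, H x <-> gen (fun y => List.In y s) x.

Definition finite_index (H : G -> Prop) : Prop :=
  exists s : list G, forall g, exists2 r, List.In r s & H (r^-1 * g).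

Definition centraliser (a : G) : G -> Prop := fun g => g * a = a * g.

(* an n-configuration: a map from non-empty subsets of [n] to {0,1};
   we encode it as c : {set 'I_n} -> bool, only non-empty I are used,
   with c I = true meaning the value 1. *)
Definition bigcapH (n : nat) (H : 'I_n -> G -> Prop) (I : {set 'I_n}) : G -> Prop :=
  fun x => forall i, i \in I -> H i x.

Definition realisable (n : nat) (c : {set 'I_n} -> bool) : Prop :=
  exists H : 'I_n -> G -> Prop,
    (forall i, is_subgroup (H i)) /\
    (forall I : {set 'I_n}, I != set0 ->
       (fin_gen (bigcapH H I) <-> c I = false)).

Definition intersection_saturated : Prop :=
  forall n : nat, 1 <= n -> forall c : {set 'I_n} -> bool, realisable c.

End GroupNotions.

(* The tree T_m with branching sequence m : nat -> nat: a vertex at level n is a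
   word v = [v_0; ...; v_{n-1}] with v_i < m i, so every vertex at level i has
   exactly m i children (m i = m_{i+1} of the paper). The root is [::] and the
   parent of a non-root vertex is obtained by deleting its last letter. *)
Definition vertex (m : nat -> nat) (v : seq nat) : Prop :=
  forall i, i < size v -> nth 0 v i < m i.

Definition at_level (m : nat -> nat) (n : nat) (v : seq nat) : Prop :=
  vertex m v /\ size v = n.

Section TreeAction.
Variables (m : nat -> nat) (G : groupType).

(* act : G -> vertices -> vertices is an action of G on the tree T_m by
   tree automorphisms (maps vertices to vertices, preserves levels and the
   ancestor relation, i.e. commutes with truncation to every lower level). *)
Definition tree_action (act : G -> seq nat -> seq nat) : Prop :=
  (forall g v, vertex m v -> vertex m (act g v)) /\
  (forall g v, vertex m v -> size (act g v) = size v) /\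
  (forall g v k, vertex m v -> act g (take k v) = take k (act g v)) /\
  (forall v, vertex m v -> act 1 v = v) /\
  (forall g h v, vertex m v -> act (g * h) v = act g (act h v)).

Definition faithful (act : G -> seq nat -> seq nat) : Prop :=
  forall g, (forall v, vertex m v -> act g v = v) -> g = 1.

Definition level_transitive (act : G -> seq nat -> seq nat) : Prop :=
  forall n u v, at_level m n u -> at_level m n v -> exists g, act g u = v.

Definition rist_vertex (act : G -> seq nat -> seq nat) (v : seq nat) : G -> Prop :=
  fun g => forall w, vertex m w -> ~~ prefix v w -> act g w = w.

(* rigid level stabiliser Rist_G(n) = prod_{v at level n} Rist_G(v), i.e. the
   subgroup generated by the Rist_G(v), v at level n *)
Definition rist_level (act : G -> seq nat -> seq nat) (n : nat) : G -> Prop :=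
  gen (fun g => exists v, at_level m n v /\ rist_vertex act v g).

Definition branch_group (act : G -> seq nat -> seq nat) : Prop :=
  (forall i, 2 <= m i) /\
  tree_action act /\ faithful act /\ level_transitive act /\
  (forall n, finite_index (rist_level act n)).

End TreeAction.

(* Main.v *)
(** Fix a level of the tree. The rigid stabilisers of its vertices are conjugate
    and span their direct product, a subgroup of finite index, which is finitely
    generated by Schreier's lemma. An element of this product commutes with [a]
    iff its coordinates are permuted by [a]; it is then determined by one
    coordinate per orbit of [a], which is fixed by the power of [a] returning the
    vertex to itself. As the centraliser of [a] is not finitely generated, some
    rigid stabiliser [K] has an automorphism [phi], conjugation by [b], whose
    fixed points do not form a finitely generated group.

    On [K^N] consider the cyclic system [x_{i+1} = x_i] ([i < N-1]),
    [x_0 = phi(x_{N-1})]. All the equations together define a copy of [Fix(phi)],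
    whereas fewer equations define a retract of [K^N], which is finitely
    generated. Imposing in [H_i], [i \in I], the equation [i] together with those
    indexed outside [I], and killing the coordinates in [H_i] for the other [i],
    makes the intersection over [J] non-finitely generated exactly for [J = I].
    One such block for each [I] with [c I = 1], on disjoint sets of vertices of a
    level that is large enough, realises [c]. *)

Require Import Defs.
From mathcomp Require Import all_boot.
From Stdlib Require List.
From Stdlib Require Import Classical.

Set Implicit Arguments. Unset Strict Implicit. Unset Printing Implicit Defensive.

Section IntersectionSaturation.
Local Open Scope group_scope.

(** Excluded middle decides which entries of [s] have a partner. This picks finitely many coset
    representatives or lifts of generators. *)
Lemma list_choice (A B : Type) (Q : A -> B -> Prop) (s : list A) :
  exists t : list B,
    (forall b, List.In b t -> exists2 a, List.In a s & Q a b) /\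
    (forall a, List.In a s -> (exists b, Q a b) -> exists2 b, List.In b t & Q a b).
Proof.
elim: s => [|a s [t [tQ Qt]]]; first by exists nil.
have [[b Qab]|nQ] := classic (exists b, Q a b).
  exists (b :: t); split=> [b' /= [<-|/tQ[a' ? ?]]|a' /= [<-|a's] ex].
  - by exists a => //; left.
  - by exists a' => //; right.
  - by exists b => //; left.
  - by have [b' ? ?] := Qt _ a's ex; exists b' => //; right.
exists t; split=> [b' /tQ[a' ? ?]|a' /= [<- //|a's]].
  by exists a' => //; right.
exact: Qt.
Qed.

Lemma In_cat (A : Type) (s t : seq A) y :
  List.In y (s ++ t) <-> List.In y s \/ List.In y t.
Proof. exact: List.in_app_iff. Qed.

(** * Finitely generated subgroups and Schreier's lemma *)

Section OneGroup.
Variable G : groupType.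
Implicit Types (H S : G -> Prop) (s : list G) (x y g : G).

Definition gens s : G -> Prop := gen (fun y => List.In y s).

Lemma gen_sub_subgroup S H x :
  is_subgroup H -> (forall y, S y -> H y) -> gen S x -> H x.
Proof. by move=> [H1 [HM HV]] SH; elim=> *; auto. Qed.

Lemma gen_subgroup S : is_subgroup (gen S).
Proof. by split; [exact: gen_one|split; [exact: gen_mul|exact: gen_inv]]. Qed.

Lemma fin_gen_iff H S : (forall x, H x <-> S x) -> fin_gen H -> fin_gen S.
Proof. by move=> HS [s sP]; exists s => x; rewrite -HS. Qed.

Lemma gens_sub s t x :
  (forall y, List.In y s -> gens t y) -> gens s x -> gens t x.
Proof. by move=> st; apply: gen_sub_subgroup => //; exact: gen_subgroup. Qed.

Lemma fin_genP H s : is_subgroup H ->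
  (forall y, List.In y s -> H y) -> (forall x, H x -> gens s x) -> fin_gen H.
Proof.
by move=> gH sH Hs; exists s => x; split=> [|]; [exact: Hs|exact: gen_sub_subgroup].
Qed.

Lemma subgroup_divl H x y : is_subgroup H -> H x -> H y -> H (x^-1 * y).
Proof. by move=> [_ [HM HV]] *; apply: HM => //; apply: HV. Qed.

Lemma subgroupI H S : is_subgroup H -> is_subgroup S -> is_subgroup (fun x => H x /\ S x).
Proof.
move=> [H1 [HM HV]] [S1 [SM SV]]; split; [by []|split].
  by move=> x y [? ?] [? ?]; split; auto.
by move=> x [? ?]; split; auto.
Qed.

Lemma centraliser_subgroup g : is_subgroup (centraliser g).
Proof.
rewrite /centraliser; split; first by rewrite mul1g mulg1.
split=> [x y xg yg|x xg]; first by rewrite -mulgA yg !mulgA xg.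
by apply: (mulgI x); rewrite !mulgA mulgV mul1g xg -mulgA mulgV mulg1.
Qed.

Lemma fin_gen_finite_index H :
  fin_gen (fun _ : G => True) -> is_subgroup H -> finite_index H -> fin_gen H.
Proof.
move=> [s sG] gH [r rH]; have [H1 [HM HV]] := gH.
(* [u] collects Schreier's generators, one [h] for each generator or inverse [x] and each
   representative [r1], with [x * r1] in the coset of [r2]. *)
have [u [uQ Qu]] := list_choice
  (fun p h => H h /\ exists2 r', List.In r' r & p.1 * p.2 = r' * h)
  (List.list_prod (s ++ map (fun x => x^-1) s) r).
(* The representative of [H] itself need not be 1, so the representatives lying in [H] are added as
   generators. *)
have [v [vQ Qv]] := list_choice (fun r' r'' => r' = r'' /\ H r') r.
have uH y : List.In y u -> H y by case/uQ => ? ? [].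
pose move_reps g := forall r1, List.In r1 r ->
  exists r2 h, [/\ List.In r2 r, gens u h & g * r1 = r2 * h].
have move_gen x : List.In x (s ++ map (fun x => x^-1) s) -> move_reps x.
  move=> xs r1 r1r.
  have [||h hu [_ [r2 r2r e]]] := Qu (x, r1); first exact/List.in_prod_iff.
    have [r2 r2r Hr2] := rH (x * r1).
    by exists (r2^-1 * (x * r1)); split=> //; exists r2 => //=; rewrite mulVKg.
  by exists r2, h; split=> //; exact: gen_base.
have moveM x y : move_reps x -> move_reps y -> move_reps (x * y).
  move=> mx my r1 /my[r2 [h [/mx[r3 [h' [r3r uh' e']]] uh e]]].
  by exists r3, (h' * h); split=> //; [exact: gen_mul|rewrite -mulgA e mulgA e' mulgA].
have move_all g : move_reps g /\ move_reps g^-1.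
  elim: g / (proj1 (sG g) I) => [x xs||x y _ [mx mxV] _ [my myV]|x _ [mx mxV]].
  - split; apply: move_gen; apply/In_cat; [by left|right].
    exact: (List.in_map (fun x => x^-1)).
  - by rewrite invg1; split=> r1 r1r; exists r1, 1;
      split; rewrite ?mul1g ?mulg1 //; exact: gen_one.
  - by rewrite invgM; split; apply: moveM.
  - by rewrite invgK.
apply: (@fin_genP _ (u ++ v)) => // [y|x Hx].
  by case/(proj1 (In_cat _ _ _)) => [/uH|/vQ[r' _ [<-]]].
have [r1 r1r Hr1] := rH 1; rewrite mulg1 in Hr1.
have {}Hr1 : H r1 by rewrite -[r1]invgK; exact: HV.
have [r2 [h [r2r uh e]]] := (move_all x).1 _ r1r.
have Hh : H h by apply: gen_sub_subgroup uh.
have Hr2 : H r2 by rewrite -[r2](mulgK h) -e; apply: (HM); [exact: HM|exact: HV].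
have in_v r' : List.In r' r -> H r' -> gens (u ++ v) r'.
  move=> r'r Hr'; have [|r'' r''v [-> _]] := Qv _ r'r; first by exists r'.
  by apply: gen_base; apply/In_cat; right.
rewrite -[x](mulgK r1) e; apply: gen_mul; last by apply: gen_inv; exact: in_v.
apply: gen_mul; first exact: in_v.
by apply: gens_sub uh => y yu; apply: gen_base; apply/In_cat; left.
Qed.

(** To [s], which takes care of the intersection with [S], one adds an element of [H] from each
    listed coset of [S] that meets [H]. *)
Lemma fin_gen_of_finite_index_sub H S s :
  is_subgroup H -> is_subgroup S -> finite_index S ->
  (forall x, List.In x s -> H x) -> (forall x, H x -> S x -> gens s x) -> fin_gen H.
Proof.
move=> gH gS [r rS] sH Hs.
have [t [tQ Qt]] := list_choice (fun r' c => H c /\ S (r'^-1 * c)) r.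
apply: (@fin_genP _ (s ++ t)) => // [y|x Hx].
  by case/(proj1 (In_cat _ _ _)) => [/sH|/tQ[? _ []]].
have [r' r'r Sx] := rS x.
have [|c ct [Hc Sc]] := Qt _ r'r; first by exists x.
have Scx : S (c^-1 * x).
  have -> : c^-1 * x = (r'^-1 * c)^-1 * (r'^-1 * x).
    by rewrite invgM invgK mulgA mulgK.
  exact: subgroup_divl.
rewrite -[x](mulVKg c); apply: gen_mul.
  by apply: gen_base; apply/In_cat; right.
apply: gens_sub (Hs _ (subgroup_divl gH Hc Hx) Scx) => y ys.
by apply: gen_base; apply/In_cat; left.
Qed.

Lemma fin_gen_family (X : finType) (A : X -> G -> Prop) :
  (forall i, fin_gen (A i)) -> exists s,
    (forall y, List.In y s -> exists i, A i y) /\ (forall i y, A i y -> gens s y).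
Proof.
move=> fA.
suff [s [sA As]] : exists s, (forall y, List.In y s -> exists i, A i y) /\
    (forall i, i \in enum X -> forall y, A i y -> gens s y).
  by exists s; split=> // i; apply: As; rewrite mem_enum.
elim: (enum X) => [|i xs [s [sA As]]]; first by exists nil.
have [t At] := fA i.
exists (t ++ s); split=> [y /In_cat[yt|/sA //]|z].
  by exists i; apply/At; exact: gen_base.
rewrite inE => /predU1P[->|zxs] y Ay.
  by apply: gens_sub (proj1 (At y) Ay) => u ut; apply: gen_base; apply/In_cat; left.
apply: gens_sub (As _ zxs _ Ay) => u us; apply: gen_base; apply/In_cat; right=> //.
Qed.

End OneGroup.

(** * Homomorphisms defined on a subgroup *)

Section Morphisms.

Definition hom_on (A B : groupType) (P : A -> Prop) (a : A -> B) :=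
  forall x y, P x -> P y -> a (x * y) = a x * a y.

Definition img (A B : groupType) (P : A -> Prop) (a : A -> B) : B -> Prop :=
  fun y => exists2 x, P x & y = a x.

Variables (A : groupType) (P : A -> Prop).
Hypothesis gP : is_subgroup P.

Lemma hom_on1 (B : groupType) (a : A -> B) : hom_on P a -> a 1 = 1.
Proof.
case: gP => P1 _ aM; apply: (mulgI (a 1)).
by rewrite -aM // !mulg1.
Qed.

Lemma hom_onV (B : groupType) (a : A -> B) x : hom_on P a -> P x -> a x^-1 = (a x)^-1.
Proof.
case: gP => _ [_ PV] aM Px; apply: (mulgI (a x)).
by rewrite -aM ?mulgV ?hom_on1 //; exact: PV.
Qed.

Lemma hom_on_inj (B : groupType) (a : A -> B) x y : hom_on P a ->
  (forall x, P x -> a x = 1 -> x = 1) -> P x -> P y -> a x = a y -> x = y.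
Proof.
move=> aM a1 Px Py e; have [_ [PM PV]] := gP.
apply: (mulgI x^-1); rewrite mulVg; apply/esym/a1; first exact: subgroup_divl.
by rewrite aM ?(hom_onV aM) ?e ?mulVg //; exact: PV.
Qed.

Lemma img_subgroup (B : groupType) (a : A -> B) : hom_on P a -> is_subgroup (img P a).
Proof.
move=> aM; have [P1 [PM PV]] := gP; split; first by exists 1; rewrite ?hom_on1.
split=> [_ _ [x Px ->] [y Py ->]|_ [x Px ->]].
  by exists (x * y); rewrite ?aM //; exact: PM.
by exists x^-1; rewrite ?hom_onV //; exact: PV.
Qed.

(** As [a] is injective on [P], the image of [b] is a quotient of the image of [a]. Generators of
    the latter are lifted to [P] and mapped by [b]. *)
Lemma fin_gen_transfer (B C : groupType) (a : A -> B) (b : A -> C) : hom_on P a -> hom_on P b ->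
  (forall x, P x -> a x = 1 -> x = 1) -> fin_gen (img P a) -> fin_gen (img P b).
Proof.
move=> aM bM a1 [s sP]; have [P1 [PM PV]] := gP.
have [t [tQ Qt]] := list_choice (fun y z => exists x, [/\ P x, y = a x & z = b x]) s.
apply: (@fin_genP _ _ t) => [|z /tQ[y _ [x [Px _ ->]]]|_ [x0 Px0 ->]].
- exact: img_subgroup.
- by exists x.
suff lift y : gens s y -> exists2 x, P x & y = a x /\ gens t (b x).
  have [|x Px [e]] := lift (a x0); first by apply/sP; exists x0.
  by rewrite (hom_on_inj aM a1 Px0 Px e).
elim: y / => [y ys||u v _ [x Px [-> tx]] _ [x' Px' [-> tx']]|u _ [x Px [-> tx]]].
- have [x Px e] : img P a y by apply/sP; exact: gen_base.
  have [|z zt [x' [Px' e' ez]]] := Qt _ ys; first by exists (b x), x.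
  by exists x' => //; split=> //; rewrite -ez; exact: gen_base.
- exists 1 => //; rewrite hom_on1 //; split=> //.
  have -> : b 1 = 1 by apply: hom_on1.
  exact: gen_one.
- by exists (x * x'); [exact: PM|rewrite aM // bM //; split=> //; exact: gen_mul].
- exists x^-1; first exact: PV.
  rewrite hom_onV //; split=> //.
  have -> : b x^-1 = (b x)^-1 by apply: hom_onV.
  exact: gen_inv.
Qed.
End Morphisms.

(** * Internal direct products *)

Section IndependentFamilies.
Variables (G : groupType) (X : finType).
Implicit Types (R F : X -> G -> Prop) (f h : {ffun X -> G}) (x y : X) (r : seq X).

(* An internal direct product of the [R x]. For rigid vertex stabilisers the
   witness [F x] will be the pointwise stabiliser of the subtree rooted at [x]. *)
Record independent R F : Prop := Independent {
  indep_subgroup : forall x, is_subgroup (R x);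
  indep_compl_subgroup : forall x, is_subgroup (F x);
  indep_comm : forall x y g k, x != y -> R x g -> R y k -> commute g k;
  indep_sub_compl : forall x y g, x != y -> R y g -> F x g;
  indep_trivI : forall x g, R x g -> F x g -> g = 1 }.

Definition tuples R : {ffun X -> G} -> Prop := fun f => forall x, R x (f x).

Definition tprod f : G := \prod_x f x.

Definition restr (A : pred X) f : {ffun X -> G} := [ffun x => if A x then f x else 1].

Lemma subgroup_prod (S : G -> Prop) r f :
  is_subgroup S -> (forall x, x \in r -> S (f x)) -> S (\prod_(x <- r) f x).
Proof.
move=> [S1 [SM _]]; elim: r => [|x r IH] Sf; first by rewrite big_nil.
rewrite big_cons; apply: SM; first by apply: Sf; rewrite mem_head.
by apply: IH => y yr; apply: Sf; rewrite inE yr orbT.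
Qed.

Variables (R F : X -> G -> Prop).
Hypothesis indepRF : independent R F.
Let P := tuples R.

Lemma tuples_subgroup : is_subgroup P.
Proof.
split; first by move=> x; rewrite ffunE; case: (indep_subgroup indepRF x).
split=> [f h Pf Ph x|f Pf x]; rewrite ffunE;
  by case: (indep_subgroup indepRF x) => _ [RM RV]; auto.
Qed.

Lemma restr_tuples A f : P f -> P (restr A f).
Proof.
move=> Pf x; rewrite ffunE; case: ifP => // _.
by case: (indep_subgroup indepRF x).
Qed.

Lemma tprod_hom : hom_on P tprod.
Proof.
move=> f h Pf Ph; rewrite /tprod; have := index_enum_uniq X.
elim: (index_enum X) => [|x r IH] /=; first by rewrite !big_nil mulg1.
move=> /andP[xr /IH{}IH]; rewrite !big_cons IH ffunE !mulgA; congr (_ * _).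
rewrite -!mulgA; congr (_ * _).
(* [h x] has to move past the [f y] with [y] in [r], all different from [x]. *)
suff : centraliser (h x) (\prod_(y <- r) f y) by [].
apply: subgroup_prod => [|y yr]; first exact: centraliser_subgroup.
apply: (indep_comm indepRF) (Pf y) (Ph x).
by apply: contraNneq xr => <-.
Qed.

Lemma tprod_restr1 x f : tprod (restr (pred1 x) f) = f x.
Proof.
rewrite /tprod; under eq_bigr do rewrite ffunE.
by rewrite -big_mkcond big_pred1_eq.
Qed.

Lemma restrC A f : f = restr A f * restr (predC A) f.
Proof. by apply/ffunP=> x; rewrite !ffunE /=; case: (A x); rewrite ?mulg1 ?mul1g. Qed.

(** Solving [tprod f = 1] for [f x] expresses it through the other coordinates, hence puts it in
    [F x], which meets [R x] trivially. *)
Lemma tprod_inj f : P f -> tprod f = 1 -> f = 1.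
Proof.
move=> Pf f1; apply/ffunP=> x; rewrite [RHS]ffunE.
apply: (indep_trivI indepRF (Pf x)).
have [_ [_ FV]] := indep_compl_subgroup indepRF x.
move: f1; rewrite {1}(restrC (pred1 x) f) tprod_hom; try exact: restr_tuples.
rewrite tprod_restr1 => /mulg1_eq e; rewrite -[f x]invgK e; apply: FV.
apply: subgroup_prod => [|y _]; first exact: indep_compl_subgroup indepRF x.
rewrite ffunE /=; case: eqVneq => [_|yx].
  by case: (indep_compl_subgroup indepRF x).
by apply: (indep_sub_compl indepRF) (Pf y); rewrite eq_sym.
Qed.

(** The order of the factors is immaterial although [G] need not be commutative: [tprod_hom] absorbs
    them one at a time. *)
Lemma prod_uniq r f : P f -> uniq r -> \prod_(x <- r) f x = tprod (restr (mem r) f).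
Proof.
move=> Pf; elim: r => [_|x r IH /= /andP[xr /IH{}IH]].
  by rewrite big_nil /tprod big1 // => x _; rewrite ffunE.
rewrite big_cons IH -(tprod_restr1 x) -tprod_hom; try exact: restr_tuples.
congr tprod; apply/ffunP=> y; rewrite !ffunE /= inE.
by case: eqVneq => [->|_] /=; rewrite ?(negPf xr) ?mulg1 ?mul1g.
Qed.

Lemma tprod_reindex (p : X -> X) f : injective p -> P f ->
  \prod_x f (p x) = tprod f.
Proof.
move=> pI Pf; rewrite -[LHS](big_map p xpredT) prod_uniq //; last first.
  by rewrite map_inj_uniq ?index_enum_uniq.
congr tprod; apply/ffunP=> y; rewrite ffunE /=; case: ifPn => // /negP[].
by apply/mapP; exists (finv p y); rewrite ?mem_index_enum ?f_finv.
Qed.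

(** * Centralisers in a direct product whose factors are permuted by conjugation *)

Section Conjugation.
Variables (p : X -> X) (a : G).
Hypotheses (pI : injective p) (pR : forall x g, R x g -> R (p x) (g ^ a^-1)).

Definition equivariant f := forall x, f (p x) = f x ^ a^-1.

Lemma equivariant_centraliser f : P f -> equivariant f -> centraliser a (tprod f).
Proof.
move=> Pf ef.
have e : tprod f ^ a^-1 = tprod f.
  rewrite -[RHS](tprod_reindex pI Pf) /tprod conjg_prod.
  by apply: eq_bigr => x _; rewrite ef.
by rewrite /centraliser -{1}e conjgE invgK mulgA mulgVK.
Qed.

(** Conjugation by [a] turns the product of [f] into that of the permuted tuple [h], and a product
    determines its tuple. *)
Lemma centraliser_equivariant f : P f -> centraliser a (tprod f) -> equivariant f.
Proof.
move=> Pf cf.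
pose h : {ffun X -> G} := [ffun x => f (finv p x) ^ a^-1].
have hp x : h (p x) = f x ^ a^-1 by rewrite ffunE finv_f.
have Ph : P h by move=> x; rewrite -[x](f_finv pI) hp; apply: pR.
suff e : f = h by move=> x; rewrite {1}e hp.
apply: (hom_on_inj tuples_subgroup tprod_hom tprod_inj) => //.
rewrite -[RHS](tprod_reindex pI Ph); under [RHS]eq_bigr do rewrite hp.
rewrite -conjg_prod -/(tprod f) conjgE invgK mulgA.
by rewrite -cf mulgK.
Qed.

(* The fixed points in [R x] of conjugation by the power of [a] that returns [x]
   to itself: these are the coordinates at [x] of the tuples commuting with [a]. *)
Definition return_fixed x : G -> Prop :=
  fun g => R x g /\ g ^ (a ^+ order p x)^-1 = g.

Definition orbit_tuple x g : {ffun X -> G} :=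
  [ffun y => if fconnect p x y then g ^ (a ^+ findex p x y)^-1 else 1].

Lemma conjg_powS g i : g ^ (a ^+ i.+1)^-1 = (g ^ (a ^+ i)^-1) ^ a^-1.
Proof. by rewrite expgS invgM conjgM. Qed.

Lemma R_iter x g i : R x g -> R (iter i p x) (g ^ (a ^+ i)^-1).
Proof.
move=> Rg; elim: i => [|i IH]; first by rewrite invg1 conjg1.
by rewrite conjg_powS; apply: pR.
Qed.

Lemma equivariant_iter f x i : equivariant f -> f (iter i p x) = f x ^ (a ^+ i)^-1.
Proof.
move=> ef; elim: i => [|i IH]; first by rewrite invg1 conjg1.
by rewrite conjg_powS -IH -ef.
Qed.

Lemma orbit_tuple_tuples x g : R x g -> P (orbit_tuple x g).
Proof.
move=> Rg y; rewrite ffunE; case: ifP => [xy|_]; last by case: (indep_subgroup indepRF y).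
by rewrite -{1}(iter_findex xy); apply: R_iter.
Qed.

Lemma orbit_tuple_equivariant x g : return_fixed x g -> equivariant (orbit_tuple x g).
Proof.
move=> [_ ga] y; rewrite !ffunE -same_fconnect1_r //.
case: ifP => [xy|_]; last by rewrite conj1g.
rewrite -conjg_powS -{1}(iter_findex xy) -iterS.
(* The exponent grows by one along the orbit, except at its last point, where it drops back to 0 and
   [ga] is what closes the cycle. *)
have := findex_max xy; rewrite leq_eqVlt => /predU1P[e|lt]; last by rewrite findex_iter.
by rewrite e iter_order // findex0 invg1 conjg1 ga.
Qed.

Lemma orbit_tuple_hom x : hom_on (fun _ => True) (orbit_tuple x).
Proof.
move=> g h _ _; apply/ffunP=> y; rewrite !ffunE.
by case: ifP; rewrite ?conjMg ?mulg1.
Qed.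

Lemma return_fixed_subgroup x : is_subgroup (return_fixed x).
Proof.
apply: subgroupI; first exact: indep_subgroup indepRF x.
split; first by rewrite conj1g.
by split=> [g h eg eh|g eg]; rewrite ?conjMg ?conjVg ?eg ?eh.
Qed.

(** An equivariant tuple is a product of orbit tuples, one for each orbit in its support, so the
    generators of the groups [return_fixed x], spread along orbits, suffice. *)
Lemma centraliser_tprod_fin_gen :
  (forall x, fin_gen (return_fixed x)) -> exists s,
    (forall g, List.In g s -> centraliser a g) /\
    (forall g, img P tprod g -> centraliser a g -> gens s g).
Proof.
move=> fg.
have [|s [sA As]] := @fin_gen_family _ _ (fun x => img (return_fixed x) (tprod \o orbit_tuple x)).
  move=> x; apply: (fin_gen_transfer (return_fixed_subgroup x) (a := id)) => //.
    move=> g h [Rg _] [Rh _] /=; rewrite orbit_tuple_hom // tprod_hom //;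
    exact: orbit_tuple_tuples.
  by apply: fin_gen_iff (fg x) => g; split=> [|[h ? ->]//]; exists g.
exists s; split=> [g /sA[x [h hx ->]]|_ [f Pf ->] cf].
  apply: equivariant_centraliser; last exact: orbit_tuple_equivariant.
  by apply: orbit_tuple_tuples; case: hx.
have {cf} := centraliser_equivariant Pf cf.
(* Induction on the size of the support, removing one orbit at a time. *)
have [k] := ubnP #|[pred x | f x != 1]|; elim: k f Pf => // k IH f Pf ltk ef.
case: (pickP [pred x | f x != 1]) => [x /= fx|f1]; last first.
  rewrite /tprod big1; first exact: gen_one.
  by move=> x _; apply/eqP; have /negbFE := f1 x.
pose f2 := restr (predC (fconnect p x)) f.
have -> : f = orbit_tuple x (f x) * f2.
  apply/ffunP=> y; rewrite !ffunE /=; case: ifP => xy; rewrite ?mul1g //= mulg1.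
  by rewrite -equivariant_iter // iter_findex.
have Pf2 : P f2 by exact: restr_tuples.
rewrite tprod_hom //; last exact: orbit_tuple_tuples.
apply: gen_mul.
  apply: (As x); exists (f x) => //; split=> //.
  by rewrite -equivariant_iter // iter_order.
apply: IH => // [|y]; last first.
  by rewrite !ffunE /= -same_fconnect1_r // ef; case: ifP; rewrite ?conj1g.
rewrite -ltnS; apply: leq_trans ltk; rewrite ltnS; apply: proper_card; apply/properP; split.
  by apply/subsetP=> y; rewrite !inE ffunE; case: ifP; rewrite ?eqxx.
by exists x; rewrite !inE // ffunE /= connect0 eqxx.
Qed.

End Conjugation.
End IndependentFamilies.

(** * Levels of the tree and rigid stabilisers *)

Section Tree.
Variable m : nat -> nat.

Fixpoint level (n : nat) : seq (seq nat) :=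
  if n is n'.+1 then [seq rcons v i | v <- level n', i <- iota 0 (m n')] else [:: [::]].

Lemma levelP n v : reflect (at_level m n v) (v \in level n).
Proof.
apply: (iffP idP); elim: n v => [|n IH] v /=.
- by rewrite inE => /eqP->; split.
- case/allpairsP => [[u i] /= [/IH[vu su]]]; rewrite mem_iota => /andP[_ lti] ->.
  split=> [j|]; rewrite size_rcons su // ltnS nth_rcons su leq_eqVlt.
  by case/predU1P => [->|ltj]; [rewrite ltnn eqxx|rewrite ltj; apply: vu; rewrite su].
- by case=> _ /size0nil->; rewrite inE.
case/lastP: v => [[]//|v i [vv]]; rewrite size_rcons => -[sv].
apply/allpairsP; exists (v, i) => /=; split=> //.
  apply: IH; split=> // j ltj; have := vv j.
  by rewrite size_rcons nth_rcons ltj; apply; exact: ltnW.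
have := vv n; rewrite size_rcons nth_rcons sv ltnn eqxx mem_iota => -> //.
Qed.

Lemma level_uniq n : uniq (level n).
Proof.
elim: n => //= n IH; apply: allpairs_uniq => //; first exact: iota_uniq.
by move=> [v i] [w j] _ _ /= /rcons_inj[-> ->].
Qed.

Lemma expn2_leq_size_level n : (forall i, 2 <= m i) -> 2 ^ n <= size (level n).
Proof.
move=> m2; elim: n => //= n IH.
by rewrite size_allpairs size_iota expnS mulnC leq_mul.
Qed.

Variables (G : groupType) (act : G -> seq nat -> seq nat).
Hypotheses (act_tree : tree_action m act) (act_faithful : faithful m act).
Implicit Types (u v w : seq nat) (g h t : G).

Let act_vertex g v : vertex m v -> vertex m (act g v).
Proof. by case: act_tree => ? _; auto. Qed.
Let size_act g v : vertex m v -> size (act g v) = size v.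
Proof. by case: act_tree => _ [? _]; auto. Qed.
Let act_take g v k : vertex m v -> act g (take k v) = take k (act g v).
Proof. by case: act_tree => _ [_ [? _]]; auto. Qed.
Let act1 v : vertex m v -> act 1 v = v.
Proof. by case: act_tree => _ [_ [_ [? _]]]; auto. Qed.
Let actM g h v : vertex m v -> act (g * h) v = act g (act h v).
Proof. by case: act_tree => _ [_ [_ [_ ?]]]; auto. Qed.

Lemma actK g v : vertex m v -> act g^-1 (act g v) = v.
Proof. by move=> vv; rewrite -actM // mulVg act1. Qed.

Lemma actKV g v : vertex m v -> act g (act g^-1 v) = v.
Proof. by move=> vv; rewrite -actM // mulgV act1. Qed.

Lemma actV_fix g v : vertex m v -> act g v = v -> act g^-1 v = v.
Proof. by move=> vv {1}<-; rewrite actK. Qed.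

Lemma act_prefix g v w : vertex m v -> vertex m w -> prefix v w -> prefix (act g v) (act g w).
Proof.
move=> vv vw; rewrite !prefixE => /eqP e.
by rewrite size_act // -act_take // e.
Qed.

Lemma prefix_act g v w : vertex m v -> vertex m w ->
  prefix (act g v) w = prefix v (act g^-1 w).
Proof.
move=> vv vw; apply/idP/idP => [|/(@act_prefix g _ _ vv (@act_vertex _ _ vw))]; last by rewrite actKV.
by move/(@act_prefix g^-1 _ _ (@act_vertex _ _ vv) vw); rewrite actK.
Qed.

(** Covers both [rist_vertex] and [below_fix]. *)
Lemma fix_subgroup (Q : seq nat -> Prop) :
  is_subgroup (fun g => forall w, vertex m w -> Q w -> act g w = w).
Proof.
split; first by move=> w vw _; exact: act1.
split=> [g h gQ hQ w vw Qw|g gQ w vw Qw]; first by rewrite actM // hQ ?gQ.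
exact: actV_fix (gQ w vw Qw).
Qed.

Definition below_fix v g := forall w, vertex m w -> prefix v w -> act g w = w.

Lemma rist_conj v g t : vertex m v ->
  rist_vertex m act v g -> rist_vertex m act (act t v) (g ^ t^-1).
Proof.
move=> vv rg w vw; rewrite prefix_act // => nvw.
have vw' := @act_vertex t^-1 _ vw.
by rewrite conjgE invgK !actM ?rg ?actKV //; exact: act_vertex.
Qed.

Lemma rist_fix u v g : vertex m u -> size u = size v -> u != v ->
  rist_vertex m act v g -> act g u = u.
Proof.
move=> vu suv uv; apply => //; apply: contra uv.
by rewrite prefixE -suv take_size.
Qed.

Lemma rist_below_fix u v g : vertex m u -> size u = size v -> u != v ->
  rist_vertex m act v g -> below_fix u g.
Proof.
move=> vu suv uv rg w vw uw; apply: rg => //; apply: contra uv.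
by move: uw; rewrite !prefixE suv => /eqP-> /eqP->.
Qed.

Lemma rist_below_trivI v g : rist_vertex m act v g -> below_fix v g -> g = 1.
Proof.
move=> rg bg; apply: act_faithful => w vw.
by have [vw'|vw'] := boolP (prefix v w); [exact: bg|exact: rg].
Qed.

(** Each of [g] and [h] fixes the other's vertex, so the commutator lies in both rigid stabilisers.
    Being in that of [v], it also fixes everything below [u], hence is trivial. *)
Lemma rist_commute u v g h : vertex m u -> vertex m v -> size u = size v -> u != v ->
  rist_vertex m act u g -> rist_vertex m act v h -> commute g h.
Proof.
move=> vu vv suv uv rg rh; apply/commgP/eqP.
have [[_ [uM uV]] [_ [vM vV]]] :
  is_subgroup (rist_vertex m act u) /\ is_subgroup (rist_vertex m act v).
  by split; exact: fix_subgroup.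
apply: (@rist_below_trivI u).
  rewrite commgEl; apply: uM; first exact: uV.
  have := @rist_conj u g h^-1 vu rg; rewrite invgK.
  by rewrite (rist_fix vu suv uv (vV _ rh)).
apply: (rist_below_fix vu suv uv); rewrite commgEr; apply: vM => //.
have := @rist_conj v h^-1 g^-1 vv (vV _ rh); rewrite invgK.
by rewrite (rist_fix vv _ _ (uV _ rg)) 1?eq_sym.
Qed.

Section Level.
Variable l : nat.

Definition lvertex := seq_sub (level l).

Lemma card_lvertex : #|{: lvertex}| = size (level l).
Proof. by rewrite card_seq_sub // level_uniq. Qed.

Lemma lvertexP (x : lvertex) : vertex m (val x) /\ size (val x) = l.
Proof. by apply/levelP; exact: (valP x). Qed.

Let vx (x : lvertex) : vertex m (val x) := proj1 (lvertexP x).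
Let sx (x : lvertex) : size (val x) = l := proj2 (lvertexP x).

Lemma lact_proof g (x : lvertex) : act g (val x) \in level l.
Proof. by apply/levelP; split; [apply: act_vertex|rewrite size_act]. Qed.

Definition lact g (x : lvertex) : lvertex := SeqSub (lact_proof g x).

Definition lrist (x : lvertex) : G -> Prop := rist_vertex m act (val x).

Lemma lact_inj g : injective (lact g).
Proof.
move=> x y /(congr1 val) /= e; apply: val_inj.
by rewrite -(actK g (@vx x)) -(actK g (@vx y)) e.
Qed.

Lemma lact_iter g x i : iter i (lact g) x = lact (g ^+ i) x.
Proof.
elim: i => [|i IH]; apply: val_inj => /=; first by rewrite act1 //; exact: vx.
by rewrite IH expgS actM //; exact: vx.
Qed.

Lemma lrist_conj g x h : lrist x h -> lrist (lact g x) (h ^ g^-1).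
Proof. by apply: rist_conj; exact: vx. Qed.

Lemma lrist_indep : independent lrist (fun x => below_fix (val x)).
Proof.
split=> [x|x|x y g h xy|x y g xy|x g].
- exact: fix_subgroup.
- exact: fix_subgroup.
- by apply: rist_commute; rewrite ?sx //; exact: vx.
- by apply: rist_below_fix; rewrite ?sx //; exact: vx.
- exact: rist_below_trivI.
Qed.

Lemma limg_subgroup : is_subgroup (img (tuples lrist) (@tprod G _)).
Proof. exact (img_subgroup (tuples_subgroup lrist_indep) (tprod_hom lrist_indep)). Qed.

Lemma rist_level_tprod g : rist_level m act l g -> img (tuples lrist) (@tprod G _) g.
Proof.
apply: (gen_sub_subgroup limg_subgroup) => {}g [v [/levelP lv rg]].
pose x : lvertex := SeqSub lv.
exists (restr (pred1 x) [ffun _ => g]); last by rewrite tprod_restr1 ffunE.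
move=> y; rewrite ffunE /=; case: eqVneq => [->|_]; first by rewrite ffunE.
by case: (indep_subgroup lrist_indep y).
Qed.

Lemma tprod_lrist_finite_index : finite_index (rist_level m act l) ->
  finite_index (img (tuples lrist) (@tprod G _)).
Proof.
move=> [s sP]; exists s => g; have [r rs rg] := sP g.
by exists r => //; exact: rist_level_tprod.
Qed.

(** Otherwise finitely many elements of the centraliser would generate its part inside the product
    of the rigid stabilisers, and finite index would make the whole centraliser finitely generated.
    The witness [b] is the power of [a] returning [x] to itself. *)
Lemma exists_return_not_fin_gen (a : G) : finite_index (rist_level m act l) ->
  ~ fin_gen (centraliser a) ->
  exists x b, act b (val x) = val x /\ ~ fin_gen (fun g => lrist x g /\ g ^ b^-1 = g).
Proof.
move=> fi nfg; apply: NNPP => nex; apply: nfg.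
have [|s [sC Cs]] :=
    centraliser_tprod_fin_gen lrist_indep (@lact_inj a) (@lrist_conj a).
  move=> x; apply: NNPP => nfg; apply: nex.
  exists x, (a ^+ order (lact a) x); split=> //.
  by rewrite -[RHS](congr1 val (iter_order (@lact_inj a) x)) lact_iter.
apply: (@fin_gen_of_finite_index_sub _ _ (img (tuples lrist) (@tprod G _)) s) => //.
- exact: centraliser_subgroup.
- exact: limg_subgroup.
- exact: tprod_lrist_finite_index.
- by move=> g cg Pg; apply: Cs.
Qed.

End Level.
End Tree.

(** * Passing to a subfamily of the factors *)

Section Subfamily.
Variables (G : groupType) (X Y : finType) (R F : X -> G -> Prop) (i : Y -> X).
Hypotheses (indepRF : independent R F) (i_inj : injective i).

Lemma indep_subfamily : independent (R \o i) (F \o i).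
Proof.
case: indepRF => gR gF RC RF RI; split=> [x|x|x y g k xy|x y g xy|x g] /=.
- exact: gR.
- exact: gF.
- by apply: RC; rewrite inj_eq.
- by apply: RF; rewrite inj_eq.
- exact: RI.
Qed.

(** The smaller product is the image of the larger one under projection; a preimage is extension by
    1 outside the range of [i]. *)
Lemma fin_gen_subfamily :
  fin_gen (img (tuples R) (@tprod G X)) -> fin_gen (img (tuples (R \o i)) (@tprod G Y)).
Proof.
pose pull (f : {ffun X -> G}) : {ffun Y -> G} := [ffun y => f (i y)].
have pullP f : tuples R f -> tuples (R \o i) (pull f) by move=> Pf y; rewrite ffunE; apply: Pf.
move=> fg.
suff : fin_gen (img (tuples R) (@tprod G Y \o pull)).
  apply: fin_gen_iff => g; split=> [[f Pf ->]|[f Pf ->]]; first by exists (pull f); auto.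
  exists [ffun x => if [pick y | i y == x] is Some y then f y else 1].
    move=> x; rewrite ffunE; case: pickP => [y /eqP <-|_]; first exact: Pf.
    by case: (indep_subgroup indepRF x).
  congr tprod; apply/ffunP=> y; rewrite !ffunE.
  by case: pickP => [z /eqP/i_inj-> //|/(_ y)]; rewrite eqxx.
apply: fin_gen_transfer fg; first exact: tuples_subgroup indepRF.
- exact: tprod_hom indepRF.
- move=> f h Pf Ph /=.
  rewrite -(tprod_hom indep_subfamily); [|exact: pullP..].
  by congr tprod; apply/ffunP=> y; rewrite !ffunE.
exact: tprod_inj indepRF.
Qed.

End Subfamily.

(** * The cyclic systems of equations *)

Section Cycles.
Variables (G : groupType) (n : nat) (c : {set 'I_n.+1} -> bool).
Let X : finType := ({set 'I_n.+1} * 'I_n.+1)%type.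
Implicit Types (I J : {set 'I_n.+1}) (e j : 'I_n.+1) (k : {ffun X -> G}).

Variables (K : G -> Prop) (b : G).
Hypotheses (gK : is_subgroup K) (Kb : forall g, K g -> K (g ^ b^-1)).

Let P : {ffun X -> G} -> Prop := tuples (fun _ => K).

Definition twist e g := if e == ord_max then g ^ b^-1 else g.

(* On the block of coordinates indexed by a set [I] with [c I = 1], the fixed
   points of [shift J], for [J] inside [I], satisfy those equations
   [k (I, e + 1) = twist e (k (I, e))] of a cycle whose index [e] is in [J] or
   outside [I]; all the other blocks are killed. *)
Definition shift J k : {ffun X -> G} := [ffun x =>
  if c x.1 && (J \subset x.1) then
    if ord_pred x.2 \in J :|: ~: x.1 then twist (ord_pred x.2) (k (x.1, ord_pred x.2))
    else k x
  else 1].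

Definition solution J k := P k /\ shift J k = k.

Lemma shift_hom J k k' : shift J (k * k') = shift J k * shift J k'.
Proof.
apply/ffunP=> x; rewrite !ffunE /twist.
by do !case: ifP => // _; rewrite ?conjMg ?mulg1.
Qed.

Lemma cycle_tuples_subgroup : is_subgroup P.
Proof.
have [K1 [KM KV]] := gK.
split; first by move=> x; rewrite ffunE.
by split=> [k k' Pk Pk' x|k Pk x]; rewrite ffunE; auto.
Qed.

Lemma shift_tuples J k : P k -> P (shift J k).
Proof.
move=> Pk x; rewrite ffunE /twist; have [K1 _] := gK.
by do !case: ifP => // _; auto.
Qed.

Lemma solution_subgroup J : is_subgroup (solution J).
Proof.
apply: subgroupI; first exact: cycle_tuples_subgroup.
have shiftM : hom_on (fun _ => True) (shift J) by move=> k k' _ _; exact: shift_hom.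
have gT : is_subgroup (fun _ : {ffun X -> G} => True) by [].
split; first by rewrite (hom_on1 gT).
by split=> [k k' e e'|k e]; rewrite ?shift_hom ?(hom_onV gT) // ?e ?e'.
Qed.

(** On a block [I] containing [J], each [j] in [J] contributes its own equation and those outside
    [I]. On any other block some [j] outside [I] kills all coordinates. Non-emptiness of [J] ensures
    that the equations common to all [j] are imposed. *)
Lemma shift_bigcap J k : J != set0 ->
  (forall j, j \in J -> shift [set j] k = k) <-> shift J k = k.
Proof.
case/set0Pn => i0 i0J; split=> [fixk|fixk j jJ]; apply/ffunP=> -[I e]; rewrite !ffunE /=.
  case: ifPn => [/andP[cI JI]|].
    case: ifP => //; rewrite inE => /orP[eJ|eI].
      have /ffunP/(_ (I, e)) := fixk _ eJ; rewrite ffunE /= cI sub1set (subsetP JI) //=.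
      by rewrite !inE eqxx.
    have /ffunP/(_ (I, e)) := fixk _ i0J; rewrite ffunE /= cI sub1set (subsetP JI) //=.
    by rewrite inE eI orbT.
  case cI: (c I) => /=; [case/subsetPn => j jJ jI|move=> _].
    have /ffunP/(_ (I, e)) := fixk _ jJ; rewrite ffunE /= cI sub1set (negPf jI) /=.
    by [].
  by have /ffunP/(_ (I, e)) := fixk _ i0J; rewrite ffunE /= cI.
have /ffunP/(_ (I, e)) := fixk; rewrite ffunE /=; case cI: (c I) => //=.
rewrite sub1set; case: (boolP (J \subset I)) => [JI|JI].
  rewrite (subsetP JI) // !inE; case: ifP => [_ ->|]; first by case: ifP.
  move/negbT; rewrite negb_or => /andP[eJ /negPf->] _; rewrite orbF.
  by case: eqVneq eJ => // ->; rewrite jJ.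
have k1 e' : k (I, e') = 1.
  by have /ffunP/(_ (I, e')) := fixk; rewrite ffunE /= cI (negPf JI).
by rewrite !k1 /twist conj1g !if_same.
Qed.

Lemma val_iter_ordS d e : val (iter d (@ordS n.+1) e) = (e + d) %% n.+1.
Proof.
elim: d => [|d IH] /=; first by rewrite addn0 modn_small.
by rewrite IH -addn1 modnDml addn1 addnS.
Qed.

Lemma iter_ordS_surj e j : exists2 d, d <= n & j = iter d.+1 (@ordS n.+1) e.
Proof.
(* Modulo [n + 1], [d + 1] is [j - e]; adding [n] first prevents truncation of the subtraction. *)
exists ((j + n - e) %% n.+1); first by rewrite -ltnS ltn_pmod.
apply: val_inj; rewrite val_iter_ordS addnS -addSn modnDmr addSn subnKC.
  by rewrite -addnS modnDr modn_small.
by apply: leq_trans (leq_addl _ _); rewrite -ltnS.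
Qed.

(** The missing equation [e] leaves the coordinate after [e] untouched, and each further coordinate
    settles at most one iteration after its predecessor. *)
Lemma iter_shift_stable J I e d q k : c I -> J \subset I -> e \notin J :|: ~: I ->
  d <= q -> iter q.+1 (shift J) k (I, iter d.+1 (@ordS n.+1) e) =
            iter q (shift J) k (I, iter d.+1 (@ordS n.+1) e).
Proof.
move=> cI JI eJ.
have step p j : iter p.+1 (shift J) k (I, ordS j) =
    if j \in J :|: ~: I then twist j (iter p (shift J) k (I, j))
    else iter p (shift J) k (I, ordS j).
  by rewrite [LHS]/= ffunE /= cI JI ordSK.
elim: d q => [|d IH] q dq; first by rewrite [iter 1 _ _]/= step (negPf eJ).
case: q dq => // q dq; rewrite [iter d.+2 _ _]iterS [LHS]step [RHS]step IH //.
by case: ifP => // nE; rewrite step nE.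
Qed.

(* Without the twist condition at some [e] in [I] outside [J], the cycles are
   broken into paths and the solutions are parametrised by arbitrary tuples. *)
Lemma solution_iter_shift J k : ~~ c J -> P k -> solution J (iter n.+1 (shift J) k).
Proof.
move=> cJ Pk; split.
  by elim: n.+1 => //= q IH; exact: shift_tuples.
apply/ffunP=> -[I j]; rewrite -iterS.
have [/andP[cI JI]|nI] := boolP (c I && (J \subset I)); last first.
  by rewrite iterS [in RHS]iterS !ffunE /= (negPf nI).
(* [c] differs at [I] and [J], so [J] is a proper subset of [I] and some equation is missing. *)
have : ~~ (I \subset J).
  by apply: contra cJ => IJ; rewrite (_ : J = I) //; apply/eqP; rewrite eqEsubset JI.
case/subsetPn => e eI eJ; have [d dn ->] := iter_ordS_surj e j.
by apply: iter_shift_stable => //; [rewrite !inE eI negb_or eJ|exact: leqW].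
Qed.

(** Together with [solution_iter_shift], this makes [iter n.+1 (shift J)] a retraction of [P] onto
    the solutions when [c J] is false. *)
Lemma iter_shift_solution J k q : solution J k -> iter q (shift J) k = k.
Proof. by case=> _ e; elim: q => //= q ->. Qed.

(** On the block [J] itself every equation is imposed: the untwisted ones make the coordinates
    equal, and the last one makes their common value fixed by the twist. *)
Lemma solution_coord J k j : c J -> solution J k ->
  k (J, j) = k (J, ord0) /\ k (J, ord0) ^ b^-1 = k (J, ord0).
Proof.
move=> cJ [_ /ffunP fixk].
have step e : k (J, ordS e) = twist e (k (J, e)).
  by rewrite -[LHS]fixk ffunE /= cJ subxx ordSK setUCr inE.
have const q : q <= n -> k (J, inord q) = k (J, ord0).
  elim: q => [_|q IH ltq]; first by congr (k (J, _)); apply: val_inj; rewrite /= inordK.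
  rewrite -IH 1?ltnW // (_ : inord q.+1 = ordS (inord q)); last first.
    by apply: val_inj; rewrite /= !inordK ?modn_small // ltnW.
  by rewrite step /twist -val_eqE /= inordK ?(ltn_eqF ltq) // ltnW.
split; first by rewrite -(const j) ?inord_val // -ltnS.
have := step ord_max; rewrite /twist eqxx.
have -> : ordS ord_max = ord0 :> 'I_n.+1 by apply: val_inj; rewrite /= modnn.
by rewrite -[ord_max in RHS]inord_val const.
Qed.

Lemma diagonal_solution J g : K g -> g ^ b^-1 = g ->
  c J -> solution J [ffun x : X => if x.1 == J then g else 1].
Proof.
move=> Kg gb cJ; have [K1 _] := gK; split; first by move=> x; rewrite ffunE; case: ifP.
apply/ffunP=> -[I e]; rewrite !ffunE /= /twist; case: (eqVneq I J) => [->|_].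
  by rewrite cJ subxx /=; do !case: ifP.
by do !case: ifP; rewrite ?conj1g.
Qed.

Variables (R F : X -> G -> Prop) (t : X -> G).
Hypotheses (indepRF : independent R F) (RK : forall x g, R x g <-> K (g ^ t x)).

(** Identifies [K^X] with the direct product of the [R x], which are conjugates of [K]. *)
Definition embed k : G := tprod [ffun x => k x ^ (t x)^-1].

Let conj_tuple k : P k -> tuples R [ffun x => k x ^ (t x)^-1].
Proof. by move=> Pk x; apply/RK; rewrite ffunE conjgKV. Qed.

Lemma embed_hom : hom_on P embed.
Proof.
move=> k k' Pk Pk'; rewrite /embed -(tprod_hom indepRF); [|exact: conj_tuple..].
by congr tprod; apply/ffunP=> x; rewrite !ffunE conjMg.
Qed.

Lemma embed_inj k : P k -> embed k = 1 -> k = 1.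
Proof.
move=> Pk /(tprod_inj indepRF (conj_tuple Pk))/ffunP k1; apply/ffunP=> x.
have := k1 x; rewrite !ffunE => /eqP; rewrite conjg_eq1 => /eqP //.
Qed.

Lemma embed_solution_hom J : hom_on (solution J) embed.
Proof. by move=> k k' [Pk _] [Pk' _]; exact: embed_hom. Qed.

Definition cycle_subgroup j : G -> Prop := img (solution [set j]) embed.

(** Injectivity of [embed] forces the preimages of [g] for the various [j] to coincide, so
    [shift_bigcap] applies. *)
Lemma bigcap_cycle_subgroup J g : J != set0 ->
  bigcapH cycle_subgroup J g <-> img (solution J) embed g.
Proof.
move=> J0; split=> [Hg|[k [Pk fixk] ->] j jJ]; last first.
  by exists k => //; split=> //; move/(shift_bigcap _ J0): fixk; apply.
have [j0 j0J] := set0Pn _ J0; have [k [Pk fixk0] gk] := Hg _ j0J.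
exists k => //; split=> //; apply/(shift_bigcap _ J0) => j jJ.
have [k' [Pk' fixk'] gk'] := Hg _ jJ.
suff -> : k = k' by [].
by apply: (hom_on_inj cycle_tuples_subgroup embed_hom embed_inj) => //; rewrite -gk.
Qed.

Lemma fin_gen_embed_solution J :
  fin_gen (img (tuples R) (@tprod G X)) -> ~~ c J -> fin_gen (img (solution J) embed).
Proof.
move=> fg cJ.
have fgE : fin_gen (img P embed).
  apply: fin_gen_iff fg => g; split=> [[f Pf ->]|[k Pk ->]]; last first.
    by exists [ffun x => k x ^ (t x)^-1] => //; exact: conj_tuple.
  exists [ffun x => f x ^ t x]; first by move=> x; rewrite ffunE; apply/RK.
  by congr tprod; apply/ffunP=> x; rewrite !ffunE conjgK.
have PS k : P k -> solution J (iter n.+1 (shift J) k) by exact: solution_iter_shift.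
suff : fin_gen (img P (embed \o iter n.+1 (shift J))).
  apply: fin_gen_iff => g; split=> [[k Pk ->]|[k Sk ->]].
    by exists (iter n.+1 (shift J) k) => //; exact: PS.
  by exists k; [case: Sk|rewrite /comp iter_shift_solution].
apply: fin_gen_transfer fgE; first exact: cycle_tuples_subgroup.
- exact: embed_hom.
- move=> k k' Pk Pk'; rewrite /comp -(embed_solution_hom (PS _ Pk) (PS _ Pk')).
  by congr embed; elim: n.+1 => //= q ->; exact: shift_hom.
exact: embed_inj.
Qed.

(** Evaluation at one coordinate of the block [J] maps the solutions onto the fixed points in [K];
    diagonal tuples give surjectivity. *)
Lemma not_fin_gen_embed_solution J :
  ~ fin_gen (fun g => K g /\ g ^ b^-1 = g) -> c J -> ~ fin_gen (img (solution J) embed).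
Proof.
move=> nfg cJ fg; apply: nfg.
suff : fin_gen (img (solution J) (fun k => k (J, ord0))).
  apply: fin_gen_iff => g; split=> [[k Sk ->]|[Kg gb]].
    by split; [case: Sk|case: (solution_coord ord0 cJ Sk)].
  exists [ffun x : X => if x.1 == J then g else 1]; first exact: diagonal_solution.
  by rewrite ffunE eqxx.
apply: fin_gen_transfer fg; first exact: solution_subgroup.
- exact: embed_solution_hom.
- by move=> k k' _ _; rewrite ffunE.
by move=> k [Pk _]; exact: embed_inj.
Qed.

Lemma realisable_cycles : fin_gen (img (tuples R) (@tprod G X)) ->
  ~ fin_gen (fun g => K g /\ g ^ b^-1 = g) -> realisable G c.
Proof.
move=> fg nfg; exists cycle_subgroup; split=> [j|J J0].
  exact (img_subgroup (solution_subgroup _) (@embed_solution_hom _)).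
have eqJ g := bigcap_cycle_subgroup g J0.
case cJ: (c J); split=> //.
  by move=> /(fin_gen_iff eqJ)/(not_fin_gen_embed_solution nfg cJ).
by move=> _; apply: fin_gen_iff (fin_gen_embed_solution fg (negbT cJ)) => g; split=> /eqJ.
Qed.

End Cycles.

End IntersectionSaturation.

(** * Choice of the level and conclusion *)

Theorem theorem3p2 (m : nat -> nat) (G : groupType) (act : G -> seq nat -> seq nat) :
  branch_group m act ->
  fin_gen (fun _ : G => True) ->
  (exists alpha : G, ~ fin_gen (centraliser alpha)) ->
  intersection_saturated G.
Proof.
move=> [m2 [actT [actF [trans fi]]]] fg [a nfg] [//|n] _ c.
pose Y : finType := ({set 'I_n.+1} * 'I_n.+1)%type.
(* Level [l] has at least [2 ^ l] vertices, which leaves room for all of [Y]. *)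
pose l := #|Y|.
have cardY : #|Y| <= #|{: lvertex m l}|.
  rewrite card_lvertex; apply: leq_trans (expn2_leq_size_level l m2).
  exact/ltnW/ltn_expl.
pose i (y : Y) : lvertex m l := enum_val (widen_ord cardY (enum_rank y)).
have i_inj : injective i.
  by move=> y z /enum_val_inj/(congr1 val) /= /ord_inj/enum_rank_inj.
have indep := @lrist_indep m G act actT actF l.
have [x [b [bx nfgx]]] := exists_return_not_fin_gen actT actF (fi l) nfg.
have fgY : fin_gen (img (tuples (@lrist m G act l \o i)) (@tprod G Y)).
  apply: (fin_gen_subfamily indep i_inj).
  apply: fin_gen_finite_index fg _ _; first exact: limg_subgroup.
  exact: tprod_lrist_finite_index.
(* Level transitivity supplies the elements conjugating the rigid stabiliser of [x] to those of the
   vertices [i y]. *)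
have [t tP] : exists t : Y -> G, forall y, act (t y) (val x) = val (i y).
  apply: (fin_all_exists (P := fun y g => act g (val x) = val (i y))) => y.
  have /= := trans l (val x) (val (i y)).
  by apply; apply/levelP; exact: valP.
have [vx _] := lvertexP x.
have rist_t y g : lrist act (i y) g <-> lrist act x (g ^ t y)%g.
  split=> rg; last first.
    have := rist_conj actT (t := t y) vx rg; rewrite conjgK.
    by rewrite tP.
  have [vy _] := lvertexP (i y).
  have := rist_conj actT (t := (t y)^-1%g) vy rg; rewrite invgK.
  by rewrite /lrist -tP (actK actT).
apply: (realisable_cycles c _ _ (indep_subfamily indep i_inj) rist_t fgY nfgx).
- exact: indep_subgroup indep x.
- move=> g; rewrite /lrist -{2}bx; exact: rist_conj.
Qed.
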